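(* Let the free energies, stress tensors, diffusive fluxes and mass fluxes of the four modeling choices (1)–(4) described in the context be related by the identifications stated there. Suppose that the pressures of the four modeling choices are selected to satisfy $$\hat{p}=\hat{\hat{p}}+\hat{\hat{\psi}}\,\{\rho\},\qquad \check{p}=\check{\check{p}}+\rho\,\check{\check{\psi}},\qquad \check{p}=\hat{p}+\hat{\mu}\,\phi .$$ Then the following four modeling restrictions (pointwise inequalities) are equivalent: $$(1)\quad \Big(\hat{\mathbf{T}}_0+\nabla\phi\otimes\frac{\partial\hat{\Psi}}{\partial\nabla\phi}+(\hat{\mu}\phi-\hat{\Psi})\mathbf{I}\Big):\nabla\mathbf{v}-\nabla(\hat{\mu}+\alpha\hat{p})\cdot\hat{\mathbf{h}}^v-\zeta(\hat{\mu}+\alpha\hat{p})\hat{\gamma}\ \ge 0,$$ $$(2)\quad \Big(\hat{\hat{\mathbf{T}}}_0+\nabla\phi\otimes\rho\frac{\partial\hat{\hat{\psi}}}{\partial\nabla\phi}+\rho\hat{\hat{\mu}}\phi\,\mathbf{I}\Big):\nabla\mathbf{v}-\nabla(\rho\hat{\hat{\mu}}+\alpha\hat{\hat{p}})\cdot\hat{\hat{\mathbf{h}}}^v-\zeta(\rho\hat{\hat{\mu}}+\alpha\hat{\hat{p}})\hat{\hat{\gamma}}\ \ge 0,$$ $$(3)\quad \Big(\check{\mathbf{T}}_0+\nabla c\otimes\frac{\partial\check{\Psi}}{\partial\nabla c}-\check{\Psi}\mathbf{I}\Big):\nabla\mathbf{v}-\nabla\Big(\frac{\check{\mu}}{\rho}+\beta\check{p}\Big)\cdot\check{\mathbf{J}}^v-\Big(\frac{\check{\mu}}{\rho}+\beta\check{p}\Big)\check{\gamma}\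 \ge 0,$$ $$(4)\quad \Big(\check{\check{\mathbf{T}}}_0+\nabla c\otimes\rho\frac{\partial\check{\check{\psi}}}{\partial\nabla c}\Big):\nabla\mathbf{v}-\nabla(\check{\check{\mu}}+\beta\check{\check{p}})\cdot\check{\check{\mathbf{J}}}^v-(\check{\check{\mu}}+\beta\check{\check{p}})\check{\check{\gamma}}\ \ge 0 .$$
   Context: **Setting.** $\Omega\subset\mathbb{R}^d$ ($d=2,3$) is open and bounded. $\rho_1,\rho_2>0$ are constants (specific densities of two incompressible constituents). All fields are functions of position $\mathbf{x}\in\Omega$ and time $t$ and are assumed sufficiently smooth; $\nabla$ and $\mathrm{div}$ act in $\mathbf{x}$. $\mathbf{v}$ is a vector field (the mixture velocity) and $\mathbf{D}=\frac12(\nabla\mathbf{v}+(\nabla\mathbf{v})^T)$. $\mathbf{I}$ is the identity tensor, $A:B=\sum_{i,j}A_{ij}B_{ij}$, and $(a\otimes b)_{ij}=a_ib_j$. **Constants.** $[\![\rho]\!]=\frac12(\rho_1-\rho_2)$, $\{\rho\}=\frac12(\rho_1+\rho_2)$, $\alpha=\frac{\rho_2-\rho_1}{\rho_1+\rho_2}=-\frac{[\![\rho]\!]}{\{\rho\}}$, $\beta=\frac{\rho_2-\rho_1}{2\rho_1\rho_2}=-\frac{[\![\rho]\!]}{\rho_1\rho_2}$, $\zeta=\frac{\rho_1+\rho_2}{2\rho_1\rho_2}=\frac{\{\rho\}}{\rho_1\rho_2}$. **Order parameters and density.** $\phi\in[-1,1]$ is a scalar field (volume fraction difference) and $c\in[-1,1]$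 a scalar field (concentration difference), related by $$c=\frac{[\![\rho]\!]+\{\rho\}\phi}{\{\rho\}+[\![\rho]\!]\phi},\qquad \phi=\frac{-[\![\rho]\!]+\{\rho\}c}{\{\rho\}-[\![\rho]\!]c}.$$ The mixture density is $\rho=\hat\rho(\phi)=\check\rho(c)$, where $\hat\rho(\phi)=\rho_1\frac{1+\phi}{2}+\rho_2\frac{1-\phi}{2}$ and $\frac{1}{\check\rho(c)}=\frac{1}{\rho_1}\frac{1+c}{2}+\frac{1}{\rho_2}\frac{1-c}{2}$. **Four modeling choices.** Each has a free energy, a stress tensor $\mathbf{T}$, a diffusive flux (a vector field), a scalar mass flux and a scalar pressure field: - (1) $\hat\Psi=\hat\Psi(\phi,\nabla\phi)$; $\hat{\mathbf{T}}$ a function of $(\phi,\nabla\phi,\hat\mu,\nabla\hat\mu,\mathbf{D},\hat p)$; $\hat{\mathbf{h}}^v$ of $(\phi,\nabla\phi,\hat\mu,\nabla\hat\mu,\nabla\hat p)$; $\hat\gamma$ of $(\phi,\hat\mu,\hat p)$; pressure $\hat p$. - (2) $\hat{\hat\psi}=\hat{\hat\psi}(\phi,\nabla\phi)$; $\hat{\hat{\mathbf{T}}}$ a function of $(\phi,\nabla\phi,\hat{\hat\mu},\nabla\hat{\hat\mu},\mathbf{D},\hat{\hat p})$; $\hat{\hat{\mathbf{h}}}^v$ of $(\phi,\nabla\phi,\hat{\hat\mu},\nabla\hat{\hat\mu},\nabla\hat{\hat p})$; $\hat{\hat\gamma}$ of $(\phi,\hat{\hat\mu},\hat{\hat p})$;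 pressure $\hat{\hat p}$. - (3) $\check\Psi=\check\Psi(c,\nabla c)$; $\check{\mathbf{T}}$ a function of $(c,\nabla c,\check\mu,\nabla\check\mu,\mathbf{D},\check p)$; $\check{\mathbf{J}}^v$ of $(c,\nabla c,\check\mu,\nabla\check\mu,\nabla\check p)$; $\check\gamma$ of $(c,\check\mu,\check p)$; pressure $\check p$. - (4) $\check{\check\psi}=\check{\check\psi}(c,\nabla c)$; $\check{\check{\mathbf{T}}}$ a function of $(c,\nabla c,\check{\check\mu},\nabla\check{\check\mu},\mathbf{D},\check{\check p})$; $\check{\check{\mathbf{J}}}^v$ of $(c,\nabla c,\check{\check\mu},\nabla\check{\check\mu},\nabla\check{\check p})$; $\check{\check\gamma}$ of $(c,\check{\check\mu},\check{\check p})$; pressure $\check{\check p}$. **Chemical potential-like quantities.** $$\hat\mu=\frac{\partial\hat\Psi}{\partial\phi}-\mathrm{div}\frac{\partial\hat\Psi}{\partial\nabla\phi},\quad \hat{\hat\mu}=\frac{\partial\hat{\hat\psi}}{\partial\phi}-\frac1\rho\mathrm{div}\Big(\rho\frac{\partial\hat{\hat\psi}}{\partial\nabla\phi}\Big),\quad \check\mu=\frac{\partial\check\Psi}{\partial c}-\mathrm{div}\frac{\partial\check\Psi}{\partial\nabla c},\quad \check{\check\mu}=\frac{\partial\check{\check\psi}}{\partial c}-\frac1\rho\mathrm{div}\Big(\rho\frac{\partial\check{\check\psi}}{\partial\nabla c}\Big).$$ **Partition of the stress.** $\hat{\mathbf{T}}_0=\hat{\mathbf{T}}+\hat p\,\mathbf{I}$,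 $\hat{\hat{\mathbf{T}}}_0=\hat{\hat{\mathbf{T}}}+\hat{\hat p}\,\mathbf{I}$, $\check{\mathbf{T}}_0=\check{\mathbf{T}}+\check p\,\mathbf{I}$, $\check{\check{\mathbf{T}}}_0=\check{\check{\mathbf{T}}}+\check{\check p}\,\mathbf{I}$. **Identifications between the modeling choices** (equalities of the evaluated fields): - free energies: $\hat\Psi(\phi,\nabla\phi)=\hat\rho(\phi)\,\hat{\hat\psi}(\phi,\nabla\phi)=\check\rho(c)\,\check{\check\psi}(c,\nabla c)=\check\Psi(c,\nabla c)$, as functions of the order parameter and its gradient under the change of variables $\phi=\phi(c)$, $\nabla\phi=\phi'(c)\nabla c$; - stress tensors: $\hat{\mathbf{T}}=\hat{\hat{\mathbf{T}}}=\check{\check{\mathbf{T}}}=\check{\mathbf{T}}$; - diffusive fluxes: $\hat{\mathbf{h}}^v=\hat{\hat{\mathbf{h}}}^v=\zeta\check{\mathbf{J}}^v=\zeta\check{\check{\mathbf{J}}}^v$; - mass fluxes: $\hat\gamma=\hat{\hat\gamma}=\check\gamma=\check{\check\gamma}$. *)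

(* Defs.v *)
From HB Require Import structures.
From mathcomp Require Import all_boot all_order all_algebra.
From mathcomp Require Import all_classical all_reals all_analysis.

Set Implicit Arguments.
Unset Strict Implicit.
Unset Printing Implicit Defensive.

Import Order.TTheory GRing.Theory Num.Theory.
Import numFieldNormedType.Exports.

Local Open Scope classical_set_scope.
Local Open Scope ring_scope.

(* [C_at k f p]: f is of class C^k in a neighbourhood of p.  On
   finite-dimensional V this is the usual notion, and f is C^k on an open set
   exactly when [C_at k f p] holds at each of its points. *)
Fixpoint C_at {R : realType} {V W : normedModType R} (k : nat)
    (f : V -> W) (p : V) : Prop :=
  match k with
  | 0 => \forall q \near p, {for q, continuous f}
  | k'.+1 => (\forall q \near p, differentiable f q)
             /\ (forall w : V, C_at k' (fun q => 'D_w f q) p)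
  end.

Definition dot {R : realType} {d : nat} (a b : 'rV[R]_d) : R :=
  \sum_i a 0 i * b 0 i.

Definition frob {R : realType} {d : nat} (A B : 'M[R]_d) : R :=
  \sum_i \sum_j A i j * B i j.

Definition outer {R : realType} {d : nat} (a b : 'rV[R]_d) : 'M[R]_d :=
  \matrix_(i, j) (a 0 i * b 0 j).

Definition pd {R : realType} {d : nat} (i : 'I_d) (f : 'rV[R]_d -> R)
    (x : 'rV[R]_d) : R :=
  'D_(delta_mx 0 i) f x.

Definition grad {R : realType} {d : nat} (f : 'rV[R]_d -> R)
    (x : 'rV[R]_d) : 'rV[R]_d :=
  \row_i pd i f x.

Definition div {R : realType} {d : nat} (F : 'rV[R]_d -> 'rV[R]_d)
    (x : 'rV[R]_d) : R :=
  \sum_i pd i (fun y => F y 0 i) x.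

(* Convention (grad v)_ij = d v_i / d x_j, the one for which the balance
   d(grad phi)/dt = grad(dphi/dt) - (grad v)^T grad phi of material derivatives
   produces the contraction (grad phi (x) dPsi/dgrad phi) : grad v. *)
Definition vgrad {R : realType} {d : nat} (v : 'rV[R]_d -> 'rV[R]_d)
    (x : 'rV[R]_d) : 'M[R]_d :=
  \matrix_(i, j) pd j (fun y => v y 0 i) x.

Definition sym_grad {R : realType} {d : nat} (v : 'rV[R]_d -> 'rV[R]_d)
    (x : 'rV[R]_d) : 'M[R]_d :=
  2^-1 *: (vgrad v x + (vgrad v x)^T).

Definition rho_jump {R : realType} (rho1 rho2 : R) : R := (rho1 - rho2) / 2.
Definition rho_avg {R : realType} (rho1 rho2 : R) : R := (rho1 + rho2) / 2.

Definition alpha {R : realType} (rho1 rho2 : R) : R :=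
  (rho2 - rho1) / (rho1 + rho2).
Definition beta {R : realType} (rho1 rho2 : R) : R :=
  (rho2 - rho1) / (2 * rho1 * rho2).
Definition zeta {R : realType} (rho1 rho2 : R) : R :=
  (rho1 + rho2) / (2 * rho1 * rho2).

Definition c_of_phi {R : realType} (rho1 rho2 : R) (s : R) : R :=
  (rho_jump rho1 rho2 + rho_avg rho1 rho2 * s)
  / (rho_avg rho1 rho2 + rho_jump rho1 rho2 * s).

Definition phi_of_c {R : realType} (rho1 rho2 : R) (s : R) : R :=
  (- rho_jump rho1 rho2 + rho_avg rho1 rho2 * s)
  / (rho_avg rho1 rho2 - rho_jump rho1 rho2 * s).

Definition rho_hat {R : realType} (rho1 rho2 : R) (s : R) : R :=
  rho1 * ((1 + s) / 2) + rho2 * ((1 - s) / 2).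

Definition rho_check {R : realType} (rho1 rho2 : R) (s : R) : R :=
  (rho1^-1 * ((1 + s) / 2) + rho2^-1 * ((1 - s) / 2))^-1.

(* Fields depend on time first, position second. *)
Definition sfield (R : realType) (d : nat) := R -> 'rV[R]_d -> R.
Definition vfield (R : realType) (d : nat) := R -> 'rV[R]_d -> 'rV[R]_d.

(* One modeling choice.  With order parameter u and chemical potential m, the
   arguments of the constitutive functions are, in this order,
     energy : u, grad u                      (per volume or per mass)
     stress : u, grad u, m, grad m, D, p
     flux   : u, grad u, m, grad m, grad p
     source : u, m, p
   whereas the pressure is an independent field. *)
Record model (R : realType) (d : nat) := Model {
  energy : R -> 'rV[R]_d -> R;
  stress : R -> 'rV[R]_d -> R -> 'rV[R]_d -> 'M[R]_d -> R -> 'M[R]_d;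
  flux : R -> 'rV[R]_d -> R -> 'rV[R]_d -> 'rV[R]_d -> 'rV[R]_d;
  source : R -> R -> R -> R;
  pressure : sfield R d }.

Definition energy_f {R : realType} {d : nat} (M : model R d)
    (u : sfield R d) : sfield R d :=
  fun t x => energy M (u t x) (grad (u t) x).

Definition energy_du {R : realType} {d : nat} (M : model R d)
    (u : sfield R d) : sfield R d :=
  fun t x => derive1 (fun s => energy M s (grad (u t) x)) (u t x).

Definition energy_dg {R : realType} {d : nat} (M : model R d)
    (u : sfield R d) : vfield R d :=
  fun t x => grad (energy M (u t x)) (grad (u t) x).

Definition mu_vol {R : realType} {d : nat} (M : model R d)
    (u : sfield R d) : sfield R d :=
  fun t x => energy_du M u t x - div (energy_dg M u t) x.

Definition mu_mass {R : realType} {d : nat} (rho : sfield R d) (M : model R d)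
    (u : sfield R d) : sfield R d :=
  fun t x => energy_du M u t x
    - (rho t x)^-1 * div (fun y => rho t y *: energy_dg M u t y) x.

Definition stress_f {R : realType} {d : nat} (M : model R d)
    (u m : sfield R d) (v : vfield R d) (t : R) (x : 'rV[R]_d) : 'M[R]_d :=
  stress M (u t x) (grad (u t) x) (m t x) (grad (m t) x)
    (sym_grad (v t) x) (pressure M t x).

Definition stress0_f {R : realType} {d : nat} (M : model R d)
    (u m : sfield R d) (v : vfield R d) (t : R) (x : 'rV[R]_d) : 'M[R]_d :=
  stress_f M u m v t x + (pressure M t x)%:M.

Definition flux_f {R : realType} {d : nat} (M : model R d)
    (u m : sfield R d) : vfield R d :=
  fun t x => flux M (u t x) (grad (u t) x) (m t x) (grad (m t) x)
    (grad (pressure M t) x).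

Definition source_f {R : realType} {d : nat} (M : model R d)
    (u m : sfield R d) : sfield R d :=
  fun t x => source M (u t x) (m t x) (pressure M t x).

Definition restriction1 {R : realType} {d : nat} (rho1 rho2 : R)
    (phi : sfield R d) (v : vfield R d) (M : model R d)
    (t : R) (x : 'rV[R]_d) : Prop :=
  let mu := mu_vol M phi in
  let g := fun y => mu t y + alpha rho1 rho2 * pressure M t y in
  0 <= frob (stress0_f M phi mu v t x
             + outer (grad (phi t) x) (energy_dg M phi t x)
             + (mu t x * phi t x - energy_f M phi t x)%:M) (vgrad (v t) x)
       - dot (grad g x) (flux_f M phi mu t x)
       - zeta rho1 rho2 * g x * source_f M phi mu t x.

Definition restriction2 {R : realType} {d : nat} (rho1 rho2 : R)
    (rho phi : sfield R d) (v : vfield R d) (M : model R d)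
    (t : R) (x : 'rV[R]_d) : Prop :=
  let mu := mu_mass rho M phi in
  let g := fun y => rho t y * mu t y + alpha rho1 rho2 * pressure M t y in
  0 <= frob (stress0_f M phi mu v t x
             + outer (grad (phi t) x) (rho t x *: energy_dg M phi t x)
             + (rho t x * mu t x * phi t x)%:M) (vgrad (v t) x)
       - dot (grad g x) (flux_f M phi mu t x)
       - zeta rho1 rho2 * g x * source_f M phi mu t x.

Definition restriction3 {R : realType} {d : nat} (rho1 rho2 : R)
    (rho c : sfield R d) (v : vfield R d) (M : model R d)
    (t : R) (x : 'rV[R]_d) : Prop :=
  let mu := mu_vol M c in
  let g := fun y => mu t y / rho t y + beta rho1 rho2 * pressure M t y in
  0 <= frob (stress0_f M c mu v t x
             + outer (grad (c t) x) (energy_dg M c t x)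
             - (energy_f M c t x)%:M) (vgrad (v t) x)
       - dot (grad g x) (flux_f M c mu t x)
       - g x * source_f M c mu t x.

Definition restriction4 {R : realType} {d : nat} (rho1 rho2 : R)
    (rho c : sfield R d) (v : vfield R d) (M : model R d)
    (t : R) (x : 'rV[R]_d) : Prop :=
  let mu := mu_mass rho M c in
  let g := fun y => mu t y + beta rho1 rho2 * pressure M t y in
  0 <= frob (stress0_f M c mu v t x
             + outer (grad (c t) x) (rho t x *: energy_dg M c t x))
            (vgrad (v t) x)
       - dot (grad g x) (flux_f M c mu t x)
       - g x * source_f M c mu t x.

(* The free energy is C^3 near every attained value of (u, grad u); only
   attained values matter, so potentials that are singular at u = 1 or u = -1
   are admitted for fields with values in the open interval. *)
Definition smooth_energy {R : realType} {d : nat} (M : model R d)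
    (u : sfield R d) (t : R) (x : 'rV[R]_d) : Prop :=
  C_at 3 (fun z : R * 'rV[R]_d => energy M z.1 z.2) (u t x, grad (u t) x).

(* Main.v *)
Require Import Defs.
From HB Require Import structures.
From mathcomp Require Import all_boot all_order all_algebra.
From mathcomp Require Import all_classical all_reals all_analysis.
From mathcomp Require Import ring lra.

(** The four restrictions are one and the same scalar inequality: each
    left-hand side equals the next at every point.  With
    [J = rho_jump], [A = rho_avg], [rho = A + J phi] and [phi = f c], where
    [f = phi_of_c], this comes from three relations between the chemical
    potentials and one relation between constants.

    - Per volume versus per mass ([mu_vol_mass]): if [Psi = r(u) psi] and
      [rho = r(u)], the product rule in [u] gives
      [mu_vol = r'(u) psi + rho mu_mass]; the divergence terms agree since
      [dPsi/dgrad u = rho dpsi/dgrad u].  For [u = phi] one has [r' = J], and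
      for [u = c] one has [r' = - beta rho^2].  The pressure shifts
      [A psi] and [rho psi] are exactly what absorbs the terms [r'(u) psi],
      because [alpha A = - J].

    - Change of order parameter ([mu_vol_reparam]): the energy in [c] is the
      energy in [phi] evaluated at [(f c, f'(c) grad c)].  Its derivative in
      [c] carries an extra term [f''(c) grad c . dPsi/dgrad phi], and so does
      the divergence of [f'(c) dPsi/dgrad phi]; they cancel, so the variational
      derivative transforms as a covector, [mu_c = f'(c) mu_phi].

    - Constants ([phi_of_c_slope_div_rho]): [f'(c) / rho + beta phi = zeta].
      Together with [beta = zeta alpha] it turns
      [mu_c / rho + beta (p + mu_phi phi)] into [zeta (mu_phi + alpha p)], the
      factor [zeta] being the one that relates the two diffusive fluxes.

    The identities between the potentials hold throughout the open set
    [Omega], hence pass to their gradients.  The free energies are only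
    identified for order parameters in the segment from -1 to 1, and a field
    may touch an end of this segment; differentiability and agreement on one
    side still determine the derivative there ([derive_eq_on_segment]). *)

Import Order.TTheory GRing.Theory Num.Theory.
Import numFieldNormedType.Exports.

Local Open Scope classical_set_scope.
Local Open Scope ring_scope.

Set Implicit Arguments.
Unset Strict Implicit.

(** * Derivatives of maps between normed spaces *)

Lemma C_at_differentiable {R : realType} {V W : normedModType R} {k : nat}
    {f : V -> W} {p : V} : C_at k.+1 f p -> differentiable f p.
Proof. by case=> /nbhs_singleton. Qed.

Lemma C_at_derive {R : realType} {V W : normedModType R} {k : nat}
    {f : V -> W} {p : V} (w : V) : C_at k.+1 f p -> C_at k ('D_w f) p.
Proof. by case=> _; apply. Qed.

(** If the difference quotient of [f] diverges, so does its multiple by a nonzero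
    [k], and the limit is then 0 by convention on both sides.  The gradients of
    the chemical potentials are rescaled in this way. *)
Lemma derive_scale (R : realType) (V : normedModType R) (k : R) (f : V -> R)
    (x v : V) : 'D_v (fun y => k * f y) x = k * 'D_v f x.
Proof.
have [->|k0] := eqVneq k 0.
  rewrite mul0r (_ : (fun y => _) = cst 0) ?derive_cst//.
  by apply/funext => y; rewrite mul0r.
have [df|ndf] := pselect (derivable f x v); first exact: deriveMl.
have ndkf : ~ derivable (fun y => k * f y) x v.
  move=> /(@derivableZ _ _ _ _ k^-1); congr (~ derivable _ x v) : ndf.
  by apply/funext => y /=; rewrite /= /GRing.scale /= mulKf.
have p0 : point = 0 :> R^o by exact: erefl.
by rewrite /derive (dvgP ndf) (dvgP ndkf) p0 mulr0.
Qed.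

(** The difference quotients of [f - g] at [s] converge and vanish for all small
    increments pointing into the segment; at an end of the segment these
    increments have one sign only, which is enough.  Needed where an order
    parameter takes the value 1 or -1. *)
Lemma derive_eq_on_segment (R : realType) (a b : R) (f g : R -> R) (s : R) :
  a < b -> a <= s <= b -> {in `[a, b], f =1 g} ->
  derivable f s 1 -> derivable g s 1 -> 'D_1 f s = 'D_1 g s.
Proof.
move=> ab /andP[as_ sb] fg df dg.
suff : 'D_1 (f - g) s = 0 by rewrite deriveB// => /subr0_eq.
have : (fun h => h^-1 *: (((f - g) \o shift s) (h *: 1) - (f - g) s)) @ 0^'
    --> 'D_1 (f - g) s by exact: derivableB.
move: ('D_1 _ s) => D /cvgrPdist_lt H.
apply/eqP; rewrite -normr_le0; apply/ler_addgt0Pr => e e0; rewrite add0r.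
have /H := e0.
rewrite /dnbhs => /nbhs_norm0P[d /= d0 Hd].
have [h [hd h0 hs]] : exists h : R, [/\ `|h| < d, h != 0 & a <= h + s <= b].
  have [sb'|bs] := ltP s b.
    exists (Num.min (d / 2) (b - s)); have h0 : 0 < Num.min (d / 2) (b - s).
      by rewrite lt_min; lra.
    split; [|lra|].
      by rewrite gtr0_norm// gt_min; apply/orP; left; lra.
    have : Num.min (d / 2) (b - s) <= b - s by rewrite ge_min lexx orbT.
    by lra.
  exists (- Num.min (d / 2) (s - a)); have h0 : 0 < Num.min (d / 2) (s - a).
    by rewrite lt_min; lra.
  split; [|lra|].
    by rewrite normrN gtr0_norm// gt_min; apply/orP; left; lra.
  have : Num.min (d / 2) (s - a) <= s - a by rewrite ge_min lexx orbT.
  by lra.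
have fgs : (f - g) s = 0 by rewrite !fctE fg ?subrr// in_itv /= as_ sb.
have fgh : (f - g) (h *: 1 + s) = 0.
  by rewrite !fctE fg ?subrr// in_itv /= /GRing.scale /= mulr1.
by have := Hd h hd h0; rewrite /= fgh fgs subrr scaler0 subr0 => /ltW.
Qed.

(** A directional derivative depends only on the function along a line.  This
    turns a partial derivative, taken with the other arguments frozen, into a
    directional derivative of the function of all arguments. *)
Lemma derive_line (R : realType) (U V W : normedModType R)
    (f : U -> W) (g : V -> W) (x u : U) (y v : V) :
  (forall h : R, f (h *: u + x) = g (h *: v + y)) -> 'D_u f x = 'D_v g y.
Proof.
move=> fg; rewrite /derive.
have fgx : f x = g y by have := fg 0; rewrite !scale0r !add0r.
rewrite (_ : (fun h => _) =
  (fun h => h^-1 *: ((g \o shift y) (h *: v) - g y)))//.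
by apply/funext => h; rewrite /= fg fgx.
Qed.

Lemma is_derive_affine (R : realType) (a b s : R) :
  is_derive s 1 (fun z => a + b * z) b.
Proof.
have -> : (fun z => a + b * z) = cst a + b \*: id.
  by apply/funext.
by apply: is_derive_eq; rewrite add0r /GRing.scale /= mulr1.
Qed.

Lemma is_derive_inv_affine (R : realType) (a b s : R) :
  a + b * s != 0 ->
  is_derive s 1 (fun z => (a + b * z)^-1) (- b / (a + b * s) ^+ 2).
Proof.
move=> n0; have [d1 d2] := is_derive_affine a b s.
split; first exact: derivableV.
have -> := @deriveV _ _ (fun z => a + b * z) s 1 n0 d1.
by rewrite d2 /GRing.scale /=; field.
Qed.

Lemma differentiable_is_derive (R : realType) (f : R -> R) (s df : R) :
  is_derive s 1 f df -> differentiable f s.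
Proof. by case=> /derivable1_diffP. Qed.

(** * Gradient, divergence and contractions *)

Lemma differentiable_rV (R : realType) (V : normedModType R) (n : nat)
    (F : V -> 'rV[R]_n) (x : V) :
  (forall i, differentiable (fun y => F y 0 i) x) -> differentiable F x.
Proof.
move=> dF; have -> : F = \sum_i (fun y => F y 0 i *: delta_mx 0 i).
  apply/funext => y; rewrite fct_sumE {1}[F y]matrix_sum_delta.
  by rewrite big_ord1.
by apply: differentiable_sum => i; apply: differentiableZl.
Qed.

Lemma differentiable_grad (R : realType) (d : nat) (k : nat) (u : 'rV[R]_d -> R)
    (x : 'rV[R]_d) : C_at k.+2 u x -> differentiable (grad u) x.
Proof.
move=> Cu; apply: differentiable_rV => i.
rewrite (_ : (fun y => _) = 'D_(delta_mx 0 i) u); last first.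
  by apply/funext => y; rewrite mxE.
exact: C_at_differentiable (C_at_derive _ Cu).
Qed.

Lemma grad_comp (R : realType) (d : nat) (f : R -> R) (df : R)
    (u : 'rV[R]_d -> R) (x : 'rV[R]_d) :
  differentiable u x -> is_derive (u x) 1 f df ->
  grad (f \o u) x = df *: grad u x.
Proof.
move=> du [fu <-]; apply/rowP => i; rewrite !mxE /pd.
move: (fu) => /derivable1_diffP dfu.
rewrite !deriveE//; last exact: differentiable_comp.
rewrite diff_comp//= -[X in 'd f _ X]mulr1 -[X in 'd f _ X]/(_ *: 1).
by rewrite linearZ/= mulrC.
Qed.

Lemma div_scale (R : realType) (d : nat) (a : 'rV[R]_d -> R)
    (F : 'rV[R]_d -> 'rV[R]_d) (x : 'rV[R]_d) :
  differentiable a x -> (forall i, differentiable (fun y => F y 0 i) x) ->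
  div (fun y => a y *: F y) x = a x * div F x + dot (grad a x) (F x).
Proof.
move=> da dF; rewrite /div /dot mulr_sumr -big_split/=; apply: eq_bigr => i _.
rewrite /pd (_ : (fun y => _) = a * (fun y => F y 0 i)); last first.
  by apply/funext => y; rewrite mxE.
rewrite deriveM; [|exact: diff_derivable..].
by rewrite mxE [X in _ + X]mulrC.
Qed.

Lemma grad_scale (R : realType) (d : nat) (k : R) (f : 'rV[R]_d -> R)
    (x : 'rV[R]_d) : grad (fun y => k * f y) x = k *: grad f x.
Proof. by apply/rowP => i; rewrite !mxE /pd derive_scale. Qed.

Lemma near_eq_grad (R : realType) (d : nat) (A : set 'rV[R]_d)
    (f g : 'rV[R]_d -> R) (x : 'rV[R]_d) :
  open A -> A x -> (forall y, A y -> f y = g y) -> grad f x = grad g x.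
Proof.
move=> oA Ax fg; apply/rowP => i; rewrite !mxE; apply: near_eq_derive.
by apply: filterS (open_nbhs_nbhs (conj oA Ax)).
Qed.

Lemma near_eq_div (R : realType) (d : nat) (A : set 'rV[R]_d)
    (F G : 'rV[R]_d -> 'rV[R]_d) (x : 'rV[R]_d) :
  open A -> A x -> (forall y, A y -> F y = G y) -> div F x = div G x.
Proof.
move=> oA Ax FG; apply: eq_bigr => i _; apply: near_eq_derive.
by apply: filterS (open_nbhs_nbhs (conj oA Ax)) => y Ay; rewrite FG.
Qed.

Lemma dotZl (R : realType) (d : nat) (k : R) (a b : 'rV[R]_d) :
  dot (k *: a) b = k * dot a b.
Proof. by rewrite /dot mulr_sumr; apply: eq_bigr => i _; rewrite mxE mulrA. Qed.

Lemma dotZr (R : realType) (d : nat) (k : R) (a b : 'rV[R]_d) :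
  dot a (k *: b) = k * dot a b.
Proof.
by rewrite /dot mulr_sumr; apply: eq_bigr => i _; rewrite mxE mulrCA.
Qed.

Lemma outerZ (R : realType) (d : nat) (k : R) (a b : 'rV[R]_d) :
  outer (k *: a) b = outer a (k *: b).
Proof. by apply/matrixP => i j; rewrite !mxE; ring. Qed.

(** * Free energies along a field *)

(** The energy as a map on one normed space, so that the chain rule applies to
    both arguments at once. *)
Definition energy_pair {R : realType} {d : nat} (M : model R d)
  (z : R * 'rV[R]_d) : R := energy M z.1 z.2.

Lemma energy_duE (R : realType) (d : nat) (M : model R d) (u : sfield R d)
    (t : R) (x : 'rV[R]_d) :
  energy_du M u t x = 'D_(1, 0) (energy_pair M) (u t x, grad (u t) x).
Proof.
rewrite /energy_du derive1E; apply: derive_line => h.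
by rewrite /energy_pair /= scaler0 add0r.
Qed.

Lemma energy_dgE (R : realType) (d : nat) (M : model R d) (u : sfield R d)
    (t : R) (x : 'rV[R]_d) (i : 'I_d) :
  energy_dg M u t x 0 i
    = 'D_(0, delta_mx 0 i) (energy_pair M) (u t x, grad (u t) x).
Proof.
rewrite /energy_dg mxE /pd; apply: derive_line => h.
by rewrite /energy_pair /= scaler0 add0r.
Qed.

Lemma smooth_energy_differentiable (R : realType) (d : nat) (M : model R d)
    (u : sfield R d) (t : R) (x : 'rV[R]_d) :
  smooth_energy M u t x ->
  differentiable (energy_pair M) (u t x, grad (u t) x).
Proof. by case=> /nbhs_singleton. Qed.

(** [dPsi/dgrad u] is differentiable along the field because it is the composite
    of a directional derivative of the energy with [(u, grad u)]; one order of
    smoothness of [u] is spent on [grad u] and one on its differentiability. *)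
Lemma differentiable_energy_dg (R : realType) (d : nat) (M : model R d)
    (k l : nat) (u : sfield R d) (t : R) (x : 'rV[R]_d) (i : 'I_d) :
  C_at k.+2 (u t) x -> C_at l.+2 (energy_pair M) (u t x, grad (u t) x) ->
  differentiable (fun y => energy_dg M u t y 0 i) x.
Proof.
move=> Cu CE.
rewrite (_ : (fun y => _) = 'D_(0, delta_mx 0 i) (energy_pair M)
   \o (fun y => (u t y, grad (u t) y))); last first.
  by apply/funext => y; rewrite energy_dgE.
apply: differentiable_comp; last exact: C_at_differentiable (C_at_derive _ CE).
apply: differentiable_pair; first exact: C_at_differentiable Cu.
exact: differentiable_grad Cu.
Qed.

Lemma diff_energy_pair (R : realType) (d : nat) (M : model R d)
    (u : sfield R d) (t : R) (x : 'rV[R]_d) (a : R) (w : 'rV[R]_d) :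
  differentiable (energy_pair M) (u t x, grad (u t) x) ->
  'd (energy_pair M) (u t x, grad (u t) x) (a, w)
    = a * energy_du M u t x + dot w (energy_dg M u t x).
Proof.
move=> dE.
have -> : (a, w) = a *: (1, 0) + \sum_i w 0 i *: (0, delta_mx 0 i)
    :> R * 'rV[R]_d.
  have -> : \sum_i w 0 i *: ((0, delta_mx 0 i) : R * 'rV[R]_d)
      = (0, \sum_i w 0 i *: delta_mx 0 i).
    elim/big_rec2: _ => // i y _ _ ->.
    by congr pair; rewrite /= scaler0 add0r.
  rewrite -row_sum_delta.
  by congr pair; rewrite /= ?scaler0 ?add0r// addr0 /GRing.scale /= mulr1.
rewrite linearD linearZ linear_sum /= energy_duE deriveE//; congr (_ + _).
by apply: eq_bigr => i _; rewrite linearZ /= energy_dgE deriveE.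
Qed.

Lemma derivable_energy (R : realType) (d : nat) (M : model R d)
    (s : R) (g : 'rV[R]_d) :
  differentiable (energy_pair M) (s, g) -> derivable (energy M ^~ g) s 1.
Proof.
move=> dE; apply/derivable1_diffP.
rewrite (_ : energy M ^~ g = energy_pair M \o (fun s => (s, g)))//.
exact: differentiable_comp.
Qed.

Lemma energy_dg_scale (R : realType) (d : nat) (Mv Mm : model R d)
    (u : sfield R d) (t k : R) (x : 'rV[R]_d) :
  (forall g, energy Mv (u t x) g = k * energy Mm (u t x) g) ->
  energy_dg Mv u t x = k *: energy_dg Mm u t x.
Proof.
move=> Ek; rewrite /energy_dg -grad_scale; congr (grad _ _).
exact/funext.
Qed.

Lemma energy_dg_reparam (R : realType) (d : nat) (M M' : model R d)
    (u w : sfield R d) (t k : R) (x : 'rV[R]_d) :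
  grad (u t) x = k *: grad (w t) x ->
  (forall g, energy M' (w t x) g = energy M (u t x) (k *: g)) ->
  differentiable (energy_pair M) (u t x, grad (u t) x) ->
  energy_dg M' w t x = k *: energy_dg M u t x.
Proof.
move=> gu E dE; apply/rowP => i; rewrite [RHS]mxE.
have -> : k * energy_dg M u t x 0 i
    = 'd (energy_pair M) (u t x, grad (u t) x) (0, k *: delta_mx 0 i).
  rewrite diff_energy_pair// mul0r add0r /dot (bigD1 i)//= big1 ?addr0.
    by rewrite !mxE !eqxx mulr1.
  by move=> j /negbTE ji; rewrite !mxE ji mulr0 mul0r.
rewrite -deriveE// mxE /pd; apply: derive_line => h.
by rewrite E /energy_pair /= gu scaler0 add0r scalerDr !scalerA mulrC.
Qed.

(** * The relation between volume fraction and concentration *)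

Lemma phi_of_c_den_gt0 (R : realType) (rho1 rho2 s : R) :
  0 < rho1 -> 0 < rho2 -> -1 <= s <= 1 ->
  0 < rho_avg rho1 rho2 - rho_jump rho1 rho2 * s.
Proof. by rewrite /rho_avg /rho_jump => h1 h2 /andP[s1 s2]; nra. Qed.

Lemma c_of_phi_den_gt0 (R : realType) (rho1 rho2 s : R) :
  0 < rho1 -> 0 < rho2 -> -1 <= s <= 1 ->
  0 < rho_avg rho1 rho2 + rho_jump rho1 rho2 * s.
Proof. by rewrite /rho_avg /rho_jump => h1 h2 /andP[s1 s2]; nra. Qed.

Lemma c_of_phi_itv (R : realType) (rho1 rho2 q : R) :
  0 < rho1 -> 0 < rho2 -> -1 <= q <= 1 -> -1 <= c_of_phi rho1 rho2 q <= 1.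
Proof.
move=> h1 h2 hq; have := c_of_phi_den_gt0 h1 h2 hq.
rewrite /c_of_phi => D0; rewrite ler_pdivlMr// ler_pdivrMr//.
by move: hq; rewrite /rho_avg /rho_jump => /andP[q1 q2]; apply/andP; split; nra.
Qed.

Lemma c_of_phiK (R : realType) (rho1 rho2 q : R) :
  0 < rho1 -> 0 < rho2 -> -1 <= q <= 1 ->
  phi_of_c rho1 rho2 (c_of_phi rho1 rho2 q) = q.
Proof.
move=> h1 h2 hq; have := c_of_phi_den_gt0 h1 h2 hq.
have := phi_of_c_den_gt0 h1 h2 (c_of_phi_itv h1 h2 hq).
rewrite /phi_of_c /c_of_phi => /lt0r_neq0 D1 /lt0r_neq0 D2.
apply: (canLR (mulfK D1)); move: D1 D2; rewrite /rho_avg /rho_jump => D1 D2.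
by field; apply: contra_neq D2; lra.
Qed.

(** The derivative of [phi_of_c] in closed form; the numerator is
    [rho_avg ^+ 2 - rho_jump ^+ 2]. *)
Definition phi_of_c_slope {R : realType} (rho1 rho2 s : R) : R :=
  rho1 * rho2 / (rho_avg rho1 rho2 - rho_jump rho1 rho2 * s) ^+ 2.

Lemma is_derive_phi_of_c (R : realType) (rho1 rho2 s : R) :
  rho_avg rho1 rho2 - rho_jump rho1 rho2 * s != 0 ->
  is_derive s 1 (phi_of_c rho1 rho2) (phi_of_c_slope rho1 rho2 s).
Proof.
rewrite -(mulNr (rho_jump _ _)) => D0.
have dn := is_derive_affine (- rho_jump rho1 rho2) (rho_avg rho1 rho2) s.
have dd := is_derive_inv_affine D0.
have -> : phi_of_c rho1 rho2
  = (fun z => - rho_jump rho1 rho2 + rho_avg rho1 rho2 * z)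
    * (fun z => (rho_avg rho1 rho2 + - rho_jump rho1 rho2 * z)^-1).
  by apply/funext => z; rewrite /phi_of_c -(mulNr (rho_jump _ _)).
apply: is_derive_eq; rewrite /phi_of_c_slope /GRing.scale /=.
move: D0; rewrite /rho_avg /rho_jump => D0.
by field; apply: contra_neq D0; lra.
Qed.

Lemma derivable_phi_of_c_slope (R : realType) (rho1 rho2 s : R) :
  rho_avg rho1 rho2 - rho_jump rho1 rho2 * s != 0 ->
  derivable (phi_of_c_slope rho1 rho2) s 1.
Proof.
rewrite -(mulNr (rho_jump _ _)) => D0.
have dd := is_derive_inv_affine D0.
have -> : phi_of_c_slope rho1 rho2 = (rho1 * rho2) \*:
    (fun z => (rho_avg rho1 rho2 + - rho_jump rho1 rho2 * z)^-1) ^+ 2.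
  by apply/funext => z; rewrite /phi_of_c_slope -(mulNr (rho_jump _ _)) -exprVn.
exact: ex_derive.
Qed.

Lemma is_derive_rho_hat (R : realType) (rho1 rho2 s : R) :
  is_derive s 1 (rho_hat rho1 rho2) (rho_jump rho1 rho2).
Proof.
have -> : rho_hat rho1 rho2
  = fun z => rho_avg rho1 rho2 + rho_jump rho1 rho2 * z.
  by apply/funext => z; rewrite /rho_hat /rho_avg /rho_jump; field.
exact: is_derive_affine.
Qed.

(** The specific volume being affine in the concentration with slope [beta], the
    density has derivative [- beta * rho ^+ 2]. *)
Lemma rho_checkE (R : realType) (rho1 rho2 s : R) :
  0 < rho1 -> 0 < rho2 ->
  rho_check rho1 rho2 s = (zeta rho1 rho2 + beta rho1 rho2 * s)^-1.
Proof.
move=> /lt0r_neq0 h1 /lt0r_neq0 h2; rewrite /rho_check /zeta /beta.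
by congr (_^-1); field; rewrite h1 h2.
Qed.

Lemma is_derive_rho_check (R : realType) (rho1 rho2 s : R) :
  0 < rho1 -> 0 < rho2 -> -1 <= s <= 1 ->
  is_derive s 1 (rho_check rho1 rho2)
    (- beta rho1 rho2 * rho_check rho1 rho2 s ^+ 2).
Proof.
move=> h1 h2 hs; rewrite rho_checkE// exprVn.
have -> : rho_check rho1 rho2
   = fun z => (zeta rho1 rho2 + beta rho1 rho2 * z)^-1.
  by apply/funext => z; rewrite rho_checkE.
apply: is_derive_inv_affine.
have := phi_of_c_den_gt0 h1 h2 hs => /lt0r_neq0; apply: contra_neq => e.
transitivity ((zeta rho1 rho2 + beta rho1 rho2 * s) * (rho1 * rho2)).
  by rewrite /zeta /beta /rho_avg /rho_jump; field; rewrite !lt0r_neq0.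
by rewrite e mul0r.
Qed.

(** With [D = rho_avg - rho_jump * s], the mixture density is
    [rho = rho1 * rho2 / D], so the slope divided by [rho] is [D^-1], an
    affine function of [phi_of_c s] with slope [- beta] and value [zeta] at 0.
    This is the identity behind the pressure shift [mu * phi]. *)
Lemma phi_of_c_slope_div_rho (R : realType) (rho1 rho2 s : R) :
  0 < rho1 -> 0 < rho2 -> -1 <= s <= 1 ->
  phi_of_c_slope rho1 rho2 s / rho_check rho1 rho2 s
    + beta rho1 rho2 * phi_of_c rho1 rho2 s = zeta rho1 rho2.
Proof.
move=> h1 h2 hs; have := phi_of_c_den_gt0 h1 h2 hs.
rewrite rho_checkE// invrK /phi_of_c_slope /phi_of_c => D.
have {}D : 0 < rho1 + rho2 - (rho1 - rho2) * s.
  by move: D; rewrite /rho_avg /rho_jump; lra.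
rewrite /zeta /beta /rho_avg /rho_jump.
by field; rewrite !lt0r_neq0.
Qed.

(** * Chemical potentials *)

(** The product rule in [u] applied to [Psi = r(u) psi].  The gradient of the
    field enters [Psi] only through [psi], so the two divergence terms are the
    divergence of the same field. *)
Lemma mu_vol_mass (R : realType) (d : nat) (A : set 'rV[R]_d)
    (Mv Mm : model R d) (u rho : sfield R d) (t : R) (r : R -> R) (dr : R)
    (x : 'rV[R]_d) :
  open A -> A x -> (forall y, A y -> -1 <= u t y <= 1) ->
  (forall y, A y -> rho t y = r (u t y)) -> rho t x != 0 ->
  (forall s g, -1 <= s <= 1 -> energy Mv s g = r s * energy Mm s g) ->
  is_derive (u t x) 1 r dr ->
  differentiable (energy_pair Mv) (u t x, grad (u t) x) ->
  differentiable (energy_pair Mm) (u t x, grad (u t) x) ->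
  mu_vol Mv u t x
    = dr * energy_f Mm u t x + rho t x * mu_mass rho Mm u t x.
Proof.
move=> oA Ax uA rhoA rho0 Evm [dr1 dr2] dEv dEm.
have du : energy_du Mv u t x
    = dr * energy_f Mm u t x + rho t x * energy_du Mm u t x.
  have dM := derivable_energy dEm.
  rewrite /energy_du !derive1E.
  rewrite (@derive_eq_on_segment _ (-1) 1 _
    (r * (energy Mm ^~ (grad (u t) x)))).
  - by rewrite deriveM// dr2 rhoA// addrC mulrC.
  - lra.
  - exact: uA.
  - by move=> s; rewrite in_itv/= => ?; rewrite Evm.
  - exact: derivable_energy.
  - exact: derivableM.
have dv : div (energy_dg Mv u t) x
    = div (fun y => rho t y *: energy_dg Mm u t y) x.
  apply: (near_eq_div oA Ax) => // y Ay; rewrite rhoA//.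
  by apply: energy_dg_scale => g; apply: Evm; exact: uA.
by rewrite /mu_vol /mu_mass du dv mulrBr mulVKf// addrA.
Qed.

(** Covariance of the variational derivative under [u = f(w)].  Since the slot
    of the gradient is filled with [f'(w) grad w], differentiating in [w]
    produces [f''(w) grad w . dPsi/dgrad u]; the product rule for the divergence
    of [f'(w) dPsi/dgrad u] produces the same term, and it cancels. *)
Lemma mu_vol_reparam (R : realType) (d : nat) (A : set 'rV[R]_d)
    (M M' : model R d) (k l : nat) (u w : sfield R d) (t : R) (f f1 : R -> R)
    (x : 'rV[R]_d) :
  open A -> A x -> (forall y, A y -> -1 <= w t y <= 1) ->
  (forall y, A y -> u t y = f (w t y)) ->
  (forall s : R, -1 <= s <= 1 -> is_derive s 1 f (f1 s)) ->
  derivable f1 (w t x) 1 ->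
  (forall s g, -1 <= s <= 1 -> energy M' s g = energy M (f s) (f1 s *: g)) ->
  (forall y, A y -> differentiable (w t) y) ->
  C_at k.+2 (u t) x ->
  (forall y, A y -> C_at l.+2 (energy_pair M) (u t y, grad (u t) y)) ->
  differentiable (energy_pair M') (w t x, grad (w t) x) ->
  mu_vol M' w t x = f1 (w t x) * mu_vol M u t x.
Proof.
move=> oA Ax wA uA df df1 E dw Cu CE dE'.
have gu y : A y -> grad (u t) y = f1 (w t y) *: grad (w t) y.
  move=> Ay; rewrite (near_eq_grad (g := f \o w t) oA Ay)//.
  by apply: grad_comp; [exact: dw|apply: df; exact: wA].
have dE y : A y -> differentiable (energy_pair M) (u t y, grad (u t) y).
  by move=> Ay; exact: C_at_differentiable (CE _ Ay).
have ddg i : differentiable (fun y => energy_dg M u t y 0 i) x.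
  exact: differentiable_energy_dg Cu (CE _ Ax).
set f2 := 'D_1 f1 (w t x).
have df1x : is_derive (w t x) 1 f1 f2 by exact: DeriveDef.
have du : energy_du M' w t x = f1 (w t x) * energy_du M u t x
    + f2 * dot (grad (w t) x) (energy_dg M u t x).
  (* The curve followed by the arguments of the energy in [u] when [w] varies
     and [grad w] is frozen. *)
  pose gam s := (f s, f1 s *: grad (w t) x).
  have gamx : gam (w t x) = (u t x, grad (u t) x) by rewrite /gam -uA// -gu.
  have /differentiable_is_derive dfx := df _ (wA _ Ax).
  have /derivable1_diffP df1' := df1.
  have dgam : differentiable gam (w t x).
    by apply: differentiable_pair => //; exact: differentiableZl.
  have dEx : differentiable (energy_pair M) (gam (w t x)).
    by rewrite gamx; exact: dE.
  rewrite {1}/energy_du derive1E.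
  rewrite (@derive_eq_on_segment _ (-1) 1 _ (energy_pair M \o gam)).
  - rewrite deriveE; last exact: differentiable_comp.
    have -> : 'd (energy_pair M \o gam) (w t x) 1
        = 'd (energy_pair M) (gam (w t x)) ('d gam (w t x) 1).
      by rewrite diff_comp.
    have -> : 'd gam (w t x) 1 = (f1 (w t x), f2 *: grad (w t) x).
      rewrite diff_pair//; last exact: differentiableZl.
      have <- : 'd f (w t x) 1 = f1 (w t x).
        by have [_ <-] := df _ (wA _ Ax); rewrite deriveE.
      have -> : f2 = 'd f1 (w t x) 1 by rewrite /f2 deriveE.
      by rewrite (diffZl _ df1').
    rewrite gamx diff_energy_pair; last exact: dE.
    congr (_ + _); rewrite /dot mulr_sumr; apply: eq_bigr => i _.
    by rewrite mxE mulrA.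
  - lra.
  - exact: wA.
  - by move=> s; rewrite in_itv/= => ?; rewrite E.
  - exact: derivable_energy.
  - by apply/derivable1_diffP; exact: differentiable_comp.
have dv : div (energy_dg M' w t) x = f1 (w t x) * div (energy_dg M u t) x
    + f2 * dot (grad (w t) x) (energy_dg M u t x).
  rewrite (near_eq_div (G := fun y => (f1 \o w t) y *: energy_dg M u t y)
    oA Ax).
    rewrite div_scale//; last first.
      apply: differentiable_comp; first exact: dw.
      exact: differentiable_is_derive df1x.
    rewrite (grad_comp (dw _ Ax) df1x).
    congr (_ + _); rewrite /dot mulr_sumr; apply: eq_bigr => i _.
    by rewrite mxE mulrA.
  move=> y Ay; apply: (energy_dg_reparam (gu _ Ay) _ (dE _ Ay)).
  by move=> g; rewrite uA//; apply: E; exact: wA.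
by rewrite /mu_vol du dv; ring.
Qed.

Unset Implicit Arguments.
Set Strict Implicit.

(** * Equivalence of the restrictions *)

Theorem theorem3p11 (R : realType) (d : nat) (hd : d = 2%N \/ d = 3%N)
    (Omega : set 'rV[R]_d) (hopen : open Omega) (hbounded : bounded_set Omega)
    (times : set R)
    (rho1 rho2 : R) (hrho1 : 0 < rho1) (hrho2 : 0 < rho2)
    (phi c rho : sfield R d) (v : vfield R d)
    (M1 M2 M3 M4 : model R d)
    (mu1 := mu_vol M1 phi) (mu2 := mu_mass rho M2 phi)
    (mu3 := mu_vol M3 c) (mu4 := mu_mass rho M4 c)
    (* order parameters and density *)
    (hphi : forall t x, times t -> Omega x -> -1 <= phi t x <= 1)
    (hc : forall t x, times t -> Omega x -> -1 <= c t x <= 1)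
    (hcphi : forall t x, times t -> Omega x ->
       c t x = c_of_phi rho1 rho2 (phi t x)
       /\ phi t x = phi_of_c rho1 rho2 (c t x))
    (hrho : forall t x, times t -> Omega x ->
       rho t x = rho_hat rho1 rho2 (phi t x)
       /\ rho t x = rho_check rho1 rho2 (c t x))
    (* smoothness *)
    (hsmooth_uv : forall t x, times t -> Omega x ->
       [/\ C_at 3 (phi t) x, C_at 3 (c t) x & C_at 1 (v t) x])
    (hsmooth_p : forall t x, times t -> Omega x ->
       [/\ C_at 1 (pressure M1 t) x, C_at 1 (pressure M2 t) x,
           C_at 1 (pressure M3 t) x & C_at 1 (pressure M4 t) x])
    (hsmooth_energy : forall t x, times t -> Omega x ->
       [/\ smooth_energy M1 phi t x, smooth_energy M2 phi t x,
           smooth_energy M3 c t x & smooth_energy M4 c t x])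
    (* identifications *)
    (henergy : forall (s : R) (g : 'rV[R]_d), -1 <= s <= 1 ->
       let q := phi_of_c rho1 rho2 s in
       let h := derive1 (phi_of_c rho1 rho2) s *: g in
       [/\ energy M1 q h = rho_hat rho1 rho2 q * energy M2 q h,
           energy M1 q h = rho_check rho1 rho2 s * energy M4 s g
         & energy M1 q h = energy M3 s g])
    (hstress : forall t x, times t -> Omega x ->
       [/\ stress_f M1 phi mu1 v t x = stress_f M2 phi mu2 v t x,
           stress_f M1 phi mu1 v t x = stress_f M4 c mu4 v t x
         & stress_f M1 phi mu1 v t x = stress_f M3 c mu3 v t x])
    (hflux : forall t x, times t -> Omega x ->
       [/\ flux_f M1 phi mu1 t x = flux_f M2 phi mu2 t x,
           flux_f M1 phi mu1 t x = zeta rho1 rho2 *: flux_f M3 c mu3 t x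
         & flux_f M1 phi mu1 t x = zeta rho1 rho2 *: flux_f M4 c mu4 t x])
    (hsource : forall t x, times t -> Omega x ->
       [/\ source_f M1 phi mu1 t x = source_f M2 phi mu2 t x,
           source_f M1 phi mu1 t x = source_f M3 c mu3 t x
         & source_f M1 phi mu1 t x = source_f M4 c mu4 t x])
    (* selection of the pressures *)
    (hpressure : forall t x, times t -> Omega x ->
       [/\ pressure M1 t x
             = pressure M2 t x + energy_f M2 phi t x * rho_avg rho1 rho2,
           pressure M3 t x = pressure M4 t x + rho t x * energy_f M4 c t x
         & pressure M3 t x = pressure M1 t x + mu1 t x * phi t x])
    (t : R) (ht : times t) (x : 'rV[R]_d) (hx : Omega x) :
  [<-> restriction1 rho1 rho2 phi v M1 t x;
       restriction2 rho1 rho2 rho phi v M2 t x;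
       restriction3 rho1 rho2 rho c v M3 t x;
       restriction4 rho1 rho2 rho c v M4 t x].
Proof.
have z0 : zeta rho1 rho2 != 0.
  by rewrite /zeta lt0r_neq0// divr_gt0 ?mulr_gt0 ?addr_gt0.
have r0 y : Omega y -> rho t y != 0.
  move=> Oy; have [-> _] := hrho t y ht Oy; move: (hphi t y ht Oy).
  by rewrite /rho_hat => /andP[? ?]; apply: lt0r_neq0; nra.
have D0 (s : R) : -1 <= s <= 1 ->
    rho_avg rho1 rho2 - rho_jump rho1 rho2 * s != 0.
  by move=> ?; rewrite lt0r_neq0// phi_of_c_den_gt0.
have slopeE (s : R) : -1 <= s <= 1 ->
    is_derive s 1 (phi_of_c rho1 rho2) (phi_of_c_slope rho1 rho2 s).
  by move=> ?; apply: is_derive_phi_of_c; exact: D0.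
have slope0 (s : R) : -1 <= s <= 1 -> phi_of_c_slope rho1 rho2 s != 0.
  move=> hs; have [n1 n2] := (lt0r_neq0 hrho1, lt0r_neq0 hrho2).
  by rewrite !mulf_neq0// invr_eq0 expf_neq0// D0.
have E (s : R) g : -1 <= s <= 1 ->
    let q := phi_of_c rho1 rho2 s in let h := phi_of_c_slope rho1 rho2 s *: g in
    [/\ energy M1 q h = rho_hat rho1 rho2 q * energy M2 q h,
        energy M3 s g = rho_check rho1 rho2 s * energy M4 s g
      & energy M3 s g = energy M1 q h].
  move=> hs; have [] := henergy s g hs; rewrite derive1E.
  by have [_ ->] := slopeE _ hs => e1 e2 e3; split => //; rewrite -?e2 e3.
(* [phi_of_c] maps the segment onto itself with nonvanishing slope, so every
   pair with first entry in the segment is of the form used in [E]. *)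
have E12 (q : R) h : -1 <= q <= 1 ->
    energy M1 q h = rho_hat rho1 rho2 q * energy M2 q h.
  move=> hq; have hs := c_of_phi_itv hrho1 hrho2 hq.
  have [+ _ _] :=
    E _ ((phi_of_c_slope rho1 rho2 (c_of_phi rho1 rho2 q))^-1 *: h) hs.
  by rewrite c_of_phiK// scalerA mulfV ?slope0// scale1r.
have C1 y : Omega y ->
    differentiable (energy_pair M1) (phi t y, grad (phi t) y).
  move=> Oy; have [CE _ _ _] := hsmooth_energy t y ht Oy.
  exact: smooth_energy_differentiable CE.
have C2 y : Omega y ->
    differentiable (energy_pair M2) (phi t y, grad (phi t) y).
  move=> Oy; have [_ CE _ _] := hsmooth_energy t y ht Oy.
  exact: smooth_energy_differentiable CE.
have C3 y : Omega y ->
    differentiable (energy_pair M3) (c t y, grad (c t) y).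
  move=> Oy; have [_ _ CE _] := hsmooth_energy t y ht Oy.
  exact: smooth_energy_differentiable CE.
have C4 y : Omega y ->
    differentiable (energy_pair M4) (c t y, grad (c t) y).
  move=> Oy; have [_ _ _ CE] := hsmooth_energy t y ht Oy.
  exact: smooth_energy_differentiable CE.
have dc y : Omega y -> differentiable (c t) y.
  move=> Oy; have [_ Cc _] := hsmooth_uv t y ht Oy.
  exact: C_at_differentiable Cc.
have phiE y : Omega y -> phi t y = phi_of_c rho1 rho2 (c t y).
  by move=> Oy; have [] := hcphi t y ht Oy.
have gphi y : Omega y ->
    grad (phi t) y = phi_of_c_slope rho1 rho2 (c t y) *: grad (c t) y.
  move=> Oy; rewrite (near_eq_grad (g := phi_of_c rho1 rho2 \o c t) hopen Oy)//.
  by apply: grad_comp; [exact: dc | apply: slopeE; exact: hc].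
have Ef y : Omega y -> [/\ energy_f M1 phi t y = rho t y * energy_f M2 phi t y,
    energy_f M3 c t y = rho t y * energy_f M4 c t y
    & energy_f M3 c t y = energy_f M1 phi t y].
  move=> Oy; have [_ e2 e3] := E _ (grad (c t) y) (hc t y ht Oy).
  have [r1 r2] := hrho t y ht Oy.
  split; rewrite /energy_f; first by rewrite r1 E12// hphi.
    by rewrite e2 r2.
  by rewrite e3 gphi// phiE.
have m12 y : Omega y -> mu1 t y
    = rho_jump rho1 rho2 * energy_f M2 phi t y + rho t y * mu2 t y.
  move=> Oy; apply: (mu_vol_mass (r := rho_hat rho1 rho2) hopen Oy).
  - by move=> ? ?; exact: hphi.
  - by move=> z Oz; have [] := hrho t z ht Oz.
  - exact: r0.
  - exact: E12.
  - exact: is_derive_rho_hat.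
  - exact: C1.
  - exact: C2.
have m34 y : Omega y -> mu3 t y
    = - beta rho1 rho2 * rho t y ^+ 2 * energy_f M4 c t y + rho t y * mu4 t y.
  move=> Oy; apply: (mu_vol_mass (r := rho_check rho1 rho2) hopen Oy).
  - by move=> ? ?; exact: hc.
  - by move=> z Oz; have [] := hrho t z ht Oz.
  - exact: r0.
  - by move=> s g hs; have [] := E s g hs.
  - have [_ ->] := hrho t y ht Oy; apply: is_derive_rho_check => //.
    exact: hc.
  - exact: C3.
  - exact: C4.
have m13 y : Omega y -> mu3 t y = phi_of_c_slope rho1 rho2 (c t y) * mu1 t y.
  move=> Oy; have [Cphi _ _] := hsmooth_uv t y ht Oy.
  apply: (mu_vol_reparam (k := 1) (l := 1) (f := phi_of_c rho1 rho2)
    (f1 := phi_of_c_slope rho1 rho2) hopen Oy).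
  - by move=> ? ?; exact: hc.
  - exact: phiE.
  - by apply: derivable_phi_of_c_slope; apply: D0; exact: hc.
  - by move=> s g hs; have [] := E s g hs.
  - exact: dc.
  - exact: Cphi.
  - by move=> z Oz; have [CE _ _ _] := hsmooth_energy t z ht Oz.
  - exact: C3.
(* The potentials that drive diffusion and mass transfer. *)
pose g1 y := mu1 t y + alpha rho1 rho2 * pressure M1 t y.
pose g2 y := rho t y * mu2 t y + alpha rho1 rho2 * pressure M2 t y.
pose g3 y := mu3 t y / rho t y + beta rho1 rho2 * pressure M3 t y.
pose g4 y := mu4 t y + beta rho1 rho2 * pressure M4 t y.
have g12 y : Omega y -> g1 y = g2 y.
  move=> Oy; rewrite /g1 /g2 m12//; have [-> _ _] := hpressure t y ht Oy.
  by rewrite /alpha /rho_avg /rho_jump; field; rewrite lt0r_neq0// addr_gt0.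
have g34 y : Omega y -> g3 y = g4 y.
  move=> Oy; rewrite /g3 /g4 m34//; have [_ -> _] := hpressure t y ht Oy.
  by field; exact: r0.
have g13 y : Omega y -> g3 y = zeta rho1 rho2 * g1 y.
  move=> Oy; rewrite /g3 /g1 m13//; have [_ _ ->] := hpressure t y ht Oy.
  have za : zeta rho1 rho2 * alpha rho1 rho2 = beta rho1 rho2.
    by rewrite /alpha /beta /zeta; field; rewrite !lt0r_neq0// addr_gt0.
  have zE := phi_of_c_slope_div_rho hrho1 hrho2 (hc t y ht Oy).
  rewrite [RHS]mulrDr [X in _ = _ + X]mulrA za -zE -phiE//.
  have [_ <-] := hrho t y ht Oy.
  by ring.
have gg12 : grad g1 x = grad g2 x by apply: (near_eq_grad hopen hx).
have gg34 : grad g3 x = grad g4 x by apply: (near_eq_grad hopen hx).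
have gg13 : grad g3 x = zeta rho1 rho2 *: grad g1 x.
  by rewrite -grad_scale; apply: (near_eq_grad hopen hx).
have [s12 s14 s13] := hstress t x ht hx.
have [f12 f13 f14] := hflux t x ht hx.
have [src12 src13 src14] := hsource t x ht hx.
have [p12 p34 p13] := hpressure t x ht hx.
have [e12 e34 e13] := Ef x hx.
have d12 : energy_dg M1 phi t x = rho t x *: energy_dg M2 phi t x.
  apply: energy_dg_scale => g; have [-> _] := hrho t x ht hx.
  by apply: E12; exact: hphi.
have d34 : energy_dg M3 c t x = rho t x *: energy_dg M4 c t x.
  apply: energy_dg_scale => g; have [_ ->] := hrho t x ht hx.
  by have [] := E _ g (hc t x ht hx).
have d13 : energy_dg M3 c t x
    = phi_of_c_slope rho1 rho2 (c t x) *: energy_dg M1 phi t x.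
  apply: (energy_dg_reparam (gphi _ hx) _ (C1 _ hx)).
  by move=> g; rewrite phiE//; have [] := E _ g (hc t x ht hx).
have f34 : flux_f M3 c mu3 t x = flux_f M4 c mu4 t x.
  by apply: (scalerI z0); rewrite -f13.
have R12 : restriction1 rho1 rho2 phi v M1 t x
    = restriction2 rho1 rho2 rho phi v M2 t x.
  rewrite /restriction1 /restriction2 /= -/mu1 -/mu2.
  rewrite -/g1 -/g2 -/(g1 x) -/(g2 x).
  rewrite gg12 f12 src12 (g12 x hx) d12; congr (0 <= frob _ _ - _ - _).
  rewrite /stress0_f s12 -!addrA; congr (_ + _).
  rewrite !addrA [LHS]addrAC [RHS]addrAC -!raddfD; congr (_%:M + _).
  rewrite p12 e12 m12// /rho_avg; have [-> _] := hrho t x ht hx.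
  by rewrite /rho_hat /rho_jump; field.
have R13 : restriction1 rho1 rho2 phi v M1 t x
    = restriction3 rho1 rho2 rho c v M3 t x.
  rewrite /restriction1 /restriction3 /= -/mu1 -/mu3.
  rewrite -/g1 -/g3 -/(g1 x) -/(g3 x).
  rewrite gg13 f13 src13 (g13 x hx) d13 dotZl dotZr -outerZ -gphi//.
  congr (0 <= frob _ _ - _ - _).
  rewrite /stress0_f s13 -!addrA; congr (_ + _).
  rewrite !addrA -raddfN [LHS]addrAC [RHS]addrAC -!raddfD; congr (_%:M + _).
  by rewrite p13 e13 addrA.
have R34 : restriction3 rho1 rho2 rho c v M3 t x
    = restriction4 rho1 rho2 rho c v M4 t x.
  rewrite /restriction3 /restriction4 /= -/mu3 -/mu4.
  rewrite -/g3 -/g4 -/(g3 x) -/(g4 x).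
  rewrite gg34 f34 -src13 src14 (g34 x hx) d34.
  congr (0 <= frob _ _ - _ - _).
  rewrite /stress0_f -s13 s14 -!addrA; congr (_ + _).
  rewrite !addrA -raddfN [LHS]addrAC -!raddfD; congr (_%:M + _).
  by rewrite p34 e34 addrK.
by rewrite -R34 -R13 -R12; tfae.
Qed.
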